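(* Let $d\ge 2$ be an integer, $V=\{1,\dots,d\}$, and let $a,b\in\mathbb{R}^V$ satisfy $0<b_i\le a_i$ for all $i\in V$ and $b_l<a_l$ for at least one $l\in V$. Let $\pi_{ii}=1$ for $i\in V$ and $\pi_{ij}=a_j/b_i$ for $i,j\in V$, $i\ne j$. Suppose $b_k=a_k$ for some $k\in V$. Let $K_d^+$ be the dual cone of the solvency cone $K_d$ induced by $\Pi=(\pi_{ij})$. Then $$K_d^+=\operatorname{cone}\{y\in\mathbb{R}^d : Q\subseteq V\setminus\{k\},\ y_i=b_i\ \forall i\in Q,\ y_j=a_j\ \forall j\in V\setminus Q\}.$$ $K_d^+$ has at most $2^{d-1}$ extreme directions. If $0<b_i<a_i$ for all $i\in V\setminus\{k\}$, then $K_d^+$ has exactly $2^{d-1}$ extreme directions.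
   Context: $\operatorname{cone} S$ denotes the set of all finite nonnegative linear combinations of elements of $S$. The solvency cone induced by $\Pi$ is $K_d=\operatorname{cone}\{\pi_{ij}e^i-e^j : (i,j)\in V\times V\}$, where $e^i$ is the $i$-th unit vector of $\mathbb{R}^d$, and $K_d^+=\{y\in\mathbb{R}^d : x^\top y\ge 0 \text{ for all } x\in K_d\}$. A vector $y\in K\setminus\{0\}$ is an extreme direction of a polyhedral convex cone $K$ if it belongs to a $1$-dimensional face of $K$; extreme directions that are positive multiples of each other are considered identical (and counted once). *)

(* Defs.v *)
(* Vectors of R^d are columns 'cV[R]_d and the index set V = {1, ..., d} is 'I_d. *)
From HB Require Import structures.
From mathcomp Require Import all_boot all_order all_algebra.
From mathcomp Require Import boolp classical_sets functions cardinality reals.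
From mathcomp Require Import convex.

Set Implicit Arguments.
Unset Strict Implicit.
Unset Printing Implicit Defensive.

Import Order.TTheory GRing.Theory Num.Theory.

Local Open Scope classical_set_scope.
Local Open Scope ring_scope.

(* The family may be empty (n = 0), so 0 always belongs to cone S. *)
Definition cone (R : realType) (E : lmodType R) (S : set E) : set E :=
  [set y | exists (n : nat) (c : 'I_n -> R) (x : 'I_n -> E),
    [/\ forall i, 0 <= c i, forall i, S (x i) & y = \sum_(i < n) c i *: x i]].

Definition unit_vec (R : realType) (d : nat) (i : 'I_d) : 'cV[R]_d :=
  delta_mx i 0.

Definition solvency_cone (R : realType) (d : nat) (Pi : 'M[R]_d) :
    set 'cV[R]_d :=
  cone [set x | exists i j : 'I_d, x = Pi i j *: unit_vec R i - unit_vec R j].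

(* x^T *m y is a 1 x 1 matrix; its only entry is the scalar product. *)
Definition dual_cone (R : realType) (d : nat) (K : set 'cV[R]_d) :
    set 'cV[R]_d :=
  [set y | forall x, K x -> 0 <= (x^T *m y) 0 0].

Definition bid_ask_matrix (R : realType) (d : nat) (a b : 'I_d -> R) :
    'M[R]_d :=
  \matrix_(i, j) (if i == j then 1 else a j / b i).

(* Faces in the sense of convex analysis: convex subsets F of K such that every
   segment of K with a relative interior point in F has both endpoints in F. *)
Definition face (R : realType) (E : lmodType R) (K F : set E) : Prop :=
  [/\ F `<=` K,
      convex_set F &
      forall (x y : E) (t : R), K x -> K y -> 0 < t -> t < 1 ->
        F (t *: x + (1 - t) *: y) -> F x /\ F y].

(* F is nonempty and its affine hull has dimension n: the hull is x0 + U, where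
   U is the smallest linear subspace containing F - x0. *)
Definition has_affine_dim (R : realType) (E : vectType R) (F : set E)
    (n : nat) : Prop :=
  exists (x0 : E) (U : {vspace E}),
    [/\ F x0,
        forall x, F x -> x - x0 \in U,
        forall W : {vspace E}, (forall x, F x -> x - x0 \in W) -> (U <= W)%VS &
        \dim U = n].

Definition extreme_direction (R : realType) (E : vectType R) (K : set E)
    (y : E) : Prop :=
  [/\ K y, y != 0 & exists F : set E, [/\ face K F, has_affine_dim F 1 & F y]].

Definition open_ray (R : realType) (E : lmodType R) (y : E) : set E :=
  [set c *: y | c in [set c : R | 0 < c]].

(* Extreme directions up to positive multiples: each class of positively
   proportional extreme directions is represented by the open ray it spans. *)
Definition extreme_directions (R : realType) (E : vectType R) (K : set E) :
    set (set E) :=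
  [set open_ray y | y in [set y | extreme_direction K y]].

(* Main.v *)
Require Import Defs.
From mathcomp Require Import all_boot all_order all_algebra.
From mathcomp Require Import boolp classical_sets functions cardinality reals.
From mathcomp Require Import interval_inference convex lra.

Set Implicit Arguments.
Unset Strict Implicit.
Unset Printing Implicit Defensive.

Import Order.TTheory GRing.Theory Num.Theory.
Local Open Scope classical_set_scope.
Local Open Scope card_scope.
Local Open Scope ring_scope.

(** Write r = y_k / a_k.  Because a_k = b_k, comparing every currency with the
    currency k turns the inequalities b_i y_j <= a_j y_i that define the dual
    cone into r b_i <= y_i <= r a_i for all i, and conversely these bounds give
    back all the pairwise inequalities through
    b_i y_j <= r b_i a_j <= a_j y_i.  A strict spread b_l < a_l forces r >= 0.
    So the dual cone is the cone over the box of all y with y_k = a_k and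
    b_i <= y_i <= a_i ([box_cone], [dual_bid_ask]).

    A box is the convex hull of its vertices: a vector of the cone is split one
    coordinate at a time into a convex combination of two vectors whose
    coordinate is extremal ([box_cone_sub]).  The vertices are the vectors
    [vertex a b Q] with Q a set of indices other than k; there are 2^(d-1) such
    sets.

    The extreme directions are exactly the rays through the vertices.  If a
    coordinate y_i lies strictly between r b_i and r a_i, then y can be moved
    both ways along e^i inside the cone, and e^i is not proportional to y
    since y_k <> 0 ([extreme_box_cone]).  At a vertex each coordinate attains
    one of its two bounds, so that in a sum of two vectors of the cone giving a
    multiple of the vertex both summands attain the same bounds
    ([vertex_extreme]).  Counting rays is then counting sets Q, and the rays
    are distinct when every spread except that of k is strict. *)

(** * Cones and extreme directions *)

Lemma cone_min (R : realType) (E : lmodType R) (S K : set E) :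
  K 0 -> (forall x y, K x -> K y -> K (x + y)) ->
  (forall c x, 0 <= c -> K x -> K (c *: x)) ->
  S `<=` K -> cone S `<=` K.
Proof.
move=> K0 KD KZ SK _ [n [c [x [c0 Sx ->]]]].
by apply: big_ind => // i _; apply/KZ/SK.
Qed.

Lemma coneZ (R : realType) (E : lmodType R) (S : set E) (c : R) (x : E) :
  0 <= c -> cone S x -> cone S (c *: x).
Proof.
move=> c0 [n [e [u [e0 Su ->]]]]; exists n, (fun i => c * e i), u; split=> //.
  by move=> i; rewrite mulr_ge0.
by rewrite scaler_sumr; apply: eq_bigr => i _; rewrite scalerA.
Qed.

Lemma coneD (R : realType) (E : lmodType R) (S : set E) (x y : E) :
  cone S x -> cone S y -> cone S (x + y).
Proof.
case=> n [c [u [c0 Su ->]]] [m [e [v [e0 Sv ->]]]].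
exists (n + m)%N,
  (fun i => match fintype.split i with inl j => c j | inr j => e j end),
  (fun i => match fintype.split i with inl j => u j | inr j => v j end).
split; [by move=> i; case: fintype.splitP|by move=> i; case: fintype.splitP|].
rewrite big_split_ord /=; congr (_ + _); apply: eq_bigr => i _.
  by rewrite (unsplitK (inl i)).
by rewrite (unsplitK (inr i)).
Qed.

Lemma subset_cone (R : realType) (E : lmodType R) (S : set E) : S `<=` cone S.
Proof.
move=> x Sx; exists 1%N, (fun=> 1), (fun=> x).
by split=> //; rewrite big_ord1 scale1r.
Qed.

Lemma dual_coneP (R : realType) (d : nat) (S : set 'cV[R]_d) (y : 'cV[R]_d) :
  dual_cone (cone S) y <-> (forall x, S x -> 0 <= (x^T *m y) 0 0).
Proof.
split=> [Ky x Sx|Sy]; first exact/Ky/subset_cone.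
apply: (@cone_min _ _ S [set x | 0 <= (x^T *m y) 0 0]) => //=.
- by rewrite trmx0 mul0mx mxE.
- by move=> x z hx hz; rewrite linearD mulmxDl mxE addr_ge0.
- by move=> c x c0 hx; rewrite linearZ -scalemxAl mxE mulr_ge0.
Qed.

(** The point [y] is the midpoint of the segment from [y - w] to [y + w] and,
    in a cone, of the segment from 0 to [2 *: y].  So the 1-dimensional face
    through [y] contains 0, its affine hull is the line spanned by [y], and
    [y + w] lies on that line. *)
Lemma extreme_direction_line (R : realType) (E : vectType R) (K : set E)
    (y w : E) :
  (forall c x, 0 <= c -> K x -> K (c *: x)) ->
  extreme_direction K y -> K (y + w) -> K (y - w) ->
  exists c : R, w = c *: y.
Proof.
move=> KZ [Ky y0 [F [[FK _ Fseg] [x0 [U [_ UF _ dimU]] Fy]]]] Kp Km.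
have h0 : 0 < 2^-1 :> R by lra.
have h1 : 2^-1 < 1 :> R by lra.
have half : 1 - 2^-1 = 2^-1 :> R by lra.
have two : 2^-1 + 2^-1 = 1 :> R by lra.
have [Fp _] : F (y + w) /\ F (y - w).
  apply: (Fseg _ _ 2^-1) => //.
  by rewrite half -scalerDr addrACA subrr addr0 scalerDr -scalerDl two scale1r.
have [F0 _] : F 0 /\ F (2 *: y).
  apply: (Fseg _ _ 2^-1) => //.
  - by rewrite -(scale0r y); apply: KZ.
  - by apply: KZ.
  - by rewrite half scaler0 add0r scalerA mulVf ?scale1r// pnatr_eq0.
have yU : y \in U.
  by have := rpredB (UF _ Fy) (UF _ F0); rewrite opprB addrA subrK subr0.
have wU : w \in U.
  have := rpredB (UF _ Fp) (UF _ Fy).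
  by rewrite opprB addrA subrK addrAC subrr add0r.
have /eqP eU : (<[y]> == U)%VS by rewrite eqEdim -memvE yU dimU dim_vline y0.
by move: wU; rewrite -eU => /vlineP.
Qed.

(** The closed ray through [y] is itself a 1-dimensional face as soon as the
    only decompositions in [K] of its points are along the ray. *)
Lemma extreme_direction_ray (R : realType) (E : vectType R) (K : set E)
    (y : E) :
  (forall c x, 0 <= c -> K x -> K (c *: x)) ->
  K y -> y != 0 ->
  (forall x z c, K x -> K z -> 0 <= c -> x + z = c *: y ->
    exists2 e, 0 <= e & x = e *: y) ->
  extreme_direction K y.
Proof.
move=> KZ Ky y0 indec; split=> //.
exists [set c *: y | c in [set c : R | 0 <= c]]; split.
- split.
  + by move=> _ [c c0 <-]; apply: KZ.
  + move=> x z t; rewrite !inE => -[c /= c0 <-] [e /= e0 <-].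
    have t0 : 0 <= t%:num by [].
    have t1 : t%:num <= 1 by [].
    exists (t%:num * c + (1 - t%:num) * e) => /=.
      by rewrite addr_ge0// mulr_ge0// subr_ge0.
    by rewrite scalerDl -!scalerA.
  + have onray s u : 0 < s -> (exists2 e, 0 <= e & s *: u = e *: y) ->
        [set c *: y | c in [set c : R | 0 <= c]] u.
      move=> s0 [e e0 h]; exists (s^-1 * e) => /=.
        by rewrite mulr_ge0// invr_ge0 ltW.
      by rewrite -scalerA -h scalerA mulVf ?scale1r// gt_eqF.
    move=> x z t Kx Kz t0 t1 [c /= c0 /esym h].
    have s0 : 0 < 1 - t by rewrite subr_gt0.
    have Ktx : K (t *: x) by apply/KZ/Kx/ltW.
    have Ksz : K ((1 - t) *: z) by apply/KZ/Kz/ltW.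
    split; [apply: (onray t) => //|apply: (onray (1 - t)) => //].
      exact: indec h.
    by apply: indec c0 _; last by rewrite addrC; exact: h.
- exists 0, <[y]>%VS; split.
  + by exists 0; rewrite /= ?scale0r.
  + by move=> _ [c _ <-]; rewrite subr0 memvZ// memv_line.
  + move=> W hW; rewrite -memvE -[y]subr0; apply: hW.
    by exists 1; rewrite /= ?scale1r.
  + by rewrite dim_vline y0.
- by exists 1; rewrite /= ?scale1r.
Qed.

Lemma open_rayZ (R : realType) (E : lmodType R) (r : R) (y : E) :
  0 < r -> open_ray (r *: y) = open_ray y.
Proof.
move=> r0; apply/seteqP; split=> _ [c /= c0 <-].
  by exists (c * r); rewrite /= ?mulr_gt0// scalerA.
exists (c / r); rewrite /= ?divr_gt0// scalerA -mulrA mulVf ?mulr1//.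
by rewrite gt_eqF.
Qed.

(** * The cone over the box *)

(** When [b k = a k] and some [b l < a l], this is the union of the
    nonnegative multiples of the box with corners [b] and [a]: a point of the
    multiple by [r] has [y k 0 = r * a k], so the factor [r] is recovered from
    [y] as [y k 0 / a k]. *)
Definition box_cone {R : realType} {d : nat} (a b : 'I_d -> R) (k : 'I_d) :
    set 'cV[R]_d :=
  [set y | forall i, y k 0 / a k * b i <= y i 0 /\ y i 0 <= y k 0 / a k * a i].

Definition vertex {R : realType} {d : nat} (a b : 'I_d -> R) (Q : {set 'I_d}) :
    'cV[R]_d :=
  \col_i (if i \in Q then b i else a i).

Lemma solvency_pairing (R : realType) (d : nat) (c : R) (i j : 'I_d)
    (y : 'cV[R]_d) :
  ((c *: unit_vec R i - unit_vec R j)^T *m y) 0 0 = c * y i 0 - y j 0.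
Proof.
rewrite linearB linearZ /= /unit_vec !trmx_delta mulmxBl -scalemxAl.
by rewrite -!rowE !mxE.
Qed.

Lemma dual_bid_ask (R : realType) (d : nat) (a b : 'I_d -> R) (k : 'I_d) :
  (forall i, 0 < b i /\ b i <= a i) -> b k = a k ->
  dual_cone (solvency_cone (bid_ask_matrix a b)) = box_cone a b k.
Proof.
move=> hab hk.
have b0 i : 0 < b i by case: (hab i).
have a0 i : 0 < a i by case: (hab i) => /lt_le_trans h /h.
have akN0 : a k != 0 by rewrite gt_eqF.
have pairs y : dual_cone (solvency_cone (bid_ask_matrix a b)) y <->
    (forall i j, i != j -> b i * y j 0 <= a j * y i 0).
  have cross_mul i j : (0 <= a j / b i * y i 0 - y j 0) =
      (b i * y j 0 <= a j * y i 0).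
    by rewrite subr_ge0 mulrAC ler_pdivlMr// [_ * b i]mulrC.
  rewrite dual_coneP; split=> [h i j ij|h _ [i [j ->]]].
    have := h _ (ex_intro _ i (ex_intro _ j erefl)).
    by rewrite solvency_pairing mxE (negbTE ij) cross_mul.
  rewrite solvency_pairing mxE; have [<-|ij] := eqVneq i j.
    by rewrite mul1r subrr.
  by rewrite cross_mul h.
apply/seteqP; split=> y; rewrite /box_cone pairs /=.
- move=> h i; have [->|ik] := eqVneq i k; first by rewrite hk divfK.
  split.
    by rewrite mulrAC ler_pdivrMr// mulrC [y i 0 * _]mulrC h.
  by rewrite mulrAC ler_pdivlMr// -hk mulrC [y k 0 * _]mulrC h// eq_sym.
- move=> h i j _; set r := y k 0 / a k in h.
  apply: (@le_trans _ _ (b i * (r * a j))).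
    by rewrite ler_pM2l//; case: (h j).
  by rewrite mulrA mulrC ler_pM2l// mulrC; case: (h i).
Qed.

Definition avoiding {d : nat} (k : 'I_d) : set {set 'I_d} :=
  [set Q | Q \subset [set~ k]%SET].

Section BoxCone.
Context {R : realType} {d : nat} {a b : 'I_d -> R} {k : 'I_d}.
Hypothesis hab : forall i, 0 < b i /\ b i <= a i.
Hypothesis hl : exists l, b l < a l.
Hypothesis hk : b k = a k.

Let a_gt0 i : 0 < a i.
Proof. by case: (hab i) => /lt_le_trans h /h. Qed.

Let akN0 : a k != 0.
Proof. by rewrite gt_eqF. Qed.

Let notinQ (Q : {set 'I_d}) : Q \subset [set~ k]%SET -> (k \in Q) = false.
Proof. by move=> /fintype.subsetP hQ; apply/negP => /hQ; rewrite !inE eqxx. Qed.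

Lemma box_cone_ge0 y : box_cone a b k y -> 0 <= y k 0 / a k.
Proof.
case: hl => l hbl /(_ l) [h1 h2].
have : 0 <= y k 0 / a k * (a l - b l).
  by rewrite mulrBr subr_ge0 (le_trans h1).
by rewrite pmulr_lge0// subr_gt0.
Qed.

Lemma box_cone_scale c y : 0 <= c -> box_cone a b k y -> box_cone a b k (c *: y).
Proof.
move=> c0 h i; rewrite !mxE; case: (h i) => h1 h2.
by rewrite -!mulrA; split; apply: ler_wpM2l => //; rewrite mulrA.
Qed.

Lemma vertexk (Q : {set 'I_d}) : Q \subset [set~ k]%SET -> vertex a b Q k 0 = a k.
Proof. by move=> hQ; rewrite mxE notinQ. Qed.

Lemma vertex_neq0 (Q : {set 'I_d}) : Q \subset [set~ k]%SET -> vertex a b Q != 0.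
Proof.
move=> hQ; apply: contra_neq akN0 => /matrixP /(_ k 0).
by rewrite vertexk // mxE.
Qed.

Lemma box_cone_vertex (Q : {set 'I_d}) : Q \subset [set~ k]%SET -> box_cone a b k (vertex a b Q).
Proof.
move=> hQ i; rewrite vertexk // divff // !mul1r mxE.
by case: (hab i) => _ h; case: ifP.
Qed.

Lemma box_cone_extremal y : box_cone a b k y ->
  (forall i, y i 0 = y k 0 / a k * b i \/ y i 0 = y k 0 / a k * a i) ->
  exists2 Q : {set 'I_d}, Q \subset [set~ k]%SET &
    y = (y k 0 / a k) *: vertex a b Q.
Proof.
move=> Ky h; set r := y k 0 / a k in h *.
(* k is kept out of Q by hand since y k 0 is both a lower and an upper bound *)
exists [set i | (i != k) && (y i 0 == r * b i)]%SET.
  by apply/fintype.subsetP => i; rewrite !inE => /andP[].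
apply/matrixP => i j; rewrite (ord1 j) !mxE inE.
case: eqVneq => [->|ik] /=; first by rewrite divfK.
by case: eqP => [//|hne]; case: (h i).
Qed.

(** Induction on the list of coordinates not yet known to be extremal: moving
    one of them to its lower and to its upper bound exhibits [y] as a convex
    combination of two vectors with one free coordinate fewer. *)
Lemma box_cone_sub :
  box_cone a b k `<=`
    cone [set vertex a b Q | Q in avoiding k].
Proof.
pose free (y : 'cV[R]_d) i :=
  ~ (y i 0 = y k 0 / a k * b i \/ y i 0 = y k 0 / a k * a i).
suff main (s : seq 'I_d) y :
    box_cone a b k y -> (forall i, free y i -> i \in s) ->
    cone [set vertex a b Q | Q in avoiding k] y.
  by move=> y Ky; apply: (main (enum 'I_d)) => // i _; rewrite mem_enum.
elim: s y => [|i s IH] y Ky fs.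
  have [i|Q hQ ->] := box_cone_extremal Ky; first by apply: contrapT => /fs.
  apply: coneZ; first exact: box_cone_ge0.
  by apply: subset_cone; exists Q.
have [fi|nfi] := pselect (free y i); last first.
  apply: IH => // j fj; have := fs j fj; rewrite inE => /orP[/eqP ji|//].
  by case: nfi; rewrite -ji.
have ik : i != k.
  by apply/eqP => ik; apply: fi; left; rewrite ik hk divfK.
set r := y k 0 / a k in Ky fs fi.
have [lo hi] := Ky i; rewrite -/r in lo hi.
have lo' : r * b i < y i 0.
  by rewrite lt_neqAle lo andbT eq_sym; apply/eqP => e; apply: fi; left.
have hi' : y i 0 < r * a i.
  by rewrite lt_neqAle hi andbT; apply/eqP => e; apply: fi; right.
pose upd v : 'cV[R]_d := \col_j (if j == i then v else y j 0).
have updk v : upd v k 0 = y k 0 by rewrite mxE eq_sym (negbTE ik).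
have upd_cone v : r * b i <= v -> v <= r * a i -> v = r * b i \/ v = r * a i ->
    cone [set vertex a b Q | Q in avoiding k] (upd v).
  move=> v1 v2 v12; apply: IH => j; rewrite ?/free updk mxE -/r.
    by case: eqVneq => [->|_]; [split|apply: Ky].
  case: eqVneq => [-> /(_ v12)//|ji fj].
  by have := fs j fj; rewrite inE (negbTE ji).
have w0 : 0 < r * a i - r * b i by rewrite subr_gt0 (lt_trans lo').
pose t := (y i 0 - r * b i) / (r * a i - r * b i).
have t0 : 0 <= t by apply: divr_ge0; [rewrite subr_ge0|apply: ltW].
have t1 : t <= 1 by rewrite ler_pdivrMr// mul1r lerB.
have tE : t * (r * a i - r * b i) = y i 0 - r * b i by rewrite divfK// gt_eqF.
have -> : y = t *: upd (r * a i) + (1 - t) *: upd (r * b i).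
  apply/matrixP => j l; rewrite (ord1 l) !mxE; case: eqVneq => [->|_]; last lra.
  by rewrite mulrBl mul1r addrCA -mulrBr tE addrC subrK.
have bb : r * b i <= r * a i by rewrite ltW// -subr_gt0.
apply: coneD; apply: coneZ; rewrite ?subr_ge0//; apply: upd_cone => //.
  by right.
by left.
Qed.

Lemma box_coneE :
  box_cone a b k =
    cone [set vertex a b Q | Q in avoiding k].
Proof.
apply/seteqP; split; first exact: box_cone_sub.
apply: cone_min.
- by move=> i; rewrite !mxE !mul0r.
- move=> x y hx hy i; rewrite !mxE 3!mulrDl.
  by case: (hx i) (hy i) => ? ? [? ?]; split; apply: lerD.
- by move=> c x; apply: box_cone_scale.
- by move=> _ [Q hQ <-]; apply: box_cone_vertex.
Qed.

(** * Extreme directions are the rays through the vertices *)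

(** If [y i 0] were strictly between its bounds, [y] could be moved both ways
    along the [i]-th unit vector without leaving the cone. *)
Lemma extreme_box_cone y : extreme_direction (box_cone a b k) y ->
  exists (r : R) (Q : {set 'I_d}), [/\ 0 < r, Q \subset [set~ k]%SET & y = r *: vertex a b Q].
Proof.
move=> ey; have [Ky y0 _] := ey; have r0 := box_cone_ge0 Ky.
have rgt0 : 0 < y k 0 / a k.
  rewrite lt_neqAle r0 andbT eq_sym; apply: contra_neq y0 => re0.
  apply/matrixP => i j; rewrite (ord1 j) mxE; have := Ky i.
  by rewrite re0 !mul0r => -[h1 h2]; apply: le_anti; rewrite h1 h2.
have yk0 : y k 0 != 0.
  by apply: contraTneq rgt0 => ->; rewrite mul0r ltxx.
have [i|Q hQ yE] := box_cone_extremal Ky; last by exists (y k 0 / a k), Q.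
apply: contrapT => /not_orP[/eqP nlo /eqP nhi].
have ik : i != k.
  by apply: contra_neq nhi => ->; rewrite divfK.
set r := y k 0 / a k in Ky r0 rgt0 nlo nhi.
have [lo hi] := Ky i; rewrite -/r in lo hi.
have lo' : 0 < y i 0 - r * b i by rewrite subr_gt0 lt_neqAle eq_sym nlo.
have hi' : 0 < r * a i - y i 0 by rewrite subr_gt0 lt_neqAle nhi.
pose e := Num.min (y i 0 - r * b i) (r * a i - y i 0).
have e0 : 0 < e by rewrite lt_min lo'.
have e1 : e <= y i 0 - r * b i by rewrite ge_min lexx.
have e2 : e <= r * a i - y i 0 by rewrite ge_min lexx orbT.
have move_in c : - e <= c -> c <= e ->
    box_cone a b k (y + c *: delta_mx i 0).
  move=> c1 c2 j; rewrite !mxE !andbT [k == i]eq_sym (negbTE ik).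
  rewrite mulr0 addr0 -/r; have [->|_] := eqVneq j i; last first.
    by rewrite mulr0 addr0; apply: Ky.
  by rewrite mulr1; split; lra.
have [||c] := extreme_direction_line box_cone_scale ey
    (_ : box_cone a b k (y + e *: delta_mx i 0)).
- by apply: move_in; lra.
- by rewrite -scaleNr; apply: move_in; lra.
move=> /matrixP ec; have := ec k 0; have := ec i 0.
rewrite !mxE !eqxx [k == i]eq_sym (negbTE ik) mulr0 mulr1 => ei /esym/eqP.
rewrite mulf_eq0 (negbTE yk0) orbF => /eqP c0.
by move: e0; rewrite ei c0 mul0r ltxx.
Qed.

(** In a sum of two vectors of the cone that is a multiple of a vertex, the
    scaling factors add up, so each bound that the vertex attains is
    attained by both summands. *)
Lemma vertex_extreme (Q : {set 'I_d}) : Q \subset [set~ k]%SET ->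
  extreme_direction (box_cone a b k) (vertex a b Q).
Proof.
move=> hQ; apply: extreme_direction_ray.
- exact: box_cone_scale.
- exact: box_cone_vertex.
- exact: vertex_neq0.
move=> x z c Kx Kz c0 /matrixP xzE.
exists (x k 0 / a k); first exact: box_cone_ge0.
have cE : c = x k 0 / a k + z k 0 / a k.
  by have := xzE k 0; rewrite !mxE notinQ // -mulrDl => ->; rewrite mulfK.
apply/matrixP => i j; rewrite (ord1 j); have := xzE i 0; rewrite !mxE cE.
have [x1 x2] := Kx i; have [z1 z2] := Kz i.
by case: ifP => _; rewrite mulrDl => E; lra.
Qed.

Lemma extreme_directions_box_cone :
  extreme_directions (box_cone a b k) =
    [set open_ray (vertex a b Q) | Q in avoiding k].
Proof.
apply/seteqP; split=> [_ [y ey <-]|_ [Q hQ <-]].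
  have [r [Q [r0 hQ ->]]] := extreme_box_cone ey.
  by exists Q; rewrite ?open_rayZ.
by exists (vertex a b Q) => //; apply: vertex_extreme.
Qed.

(** All vertices have the same [k]-th coordinate, so proportional vertices are
    equal, and a strict spread reads off membership in [Q]. *)
Lemma open_ray_vertex_inj : (forall i, i != k -> b i < a i) ->
  {in avoiding k &,
    injective (fun Q => open_ray (vertex a b Q))}.
Proof.
move=> hlt Q1 Q2; rewrite !inE /= => h1 h2 eray.
have [c _ cE] : open_ray (vertex a b Q2) (vertex a b Q1).
  by rewrite -eray; exists 1; rewrite /= ?ltr01 ?scale1r.
have c1 : c = 1.
  have /matrixP /(_ k 0) := cE; rewrite mxE !vertexk // => h.
  by apply: (mulIf akN0); rewrite h mul1r.
move: cE; rewrite c1 scale1r => /matrixP E; apply/setP => i.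
have [->|/hlt ilt] := eqVneq i k; first by rewrite !notinQ.
have := E i 0; rewrite !mxE.
by case: (i \in Q1); case: (i \in Q2) => // h; move: ilt; rewrite h ltxx.
Qed.

End BoxCone.

Lemma card_eq_finset (T : finType) (A : {set T}) :
  [set x | x \in A] #= `I_#|A|.
Proof.
have -> : [set x | x \in A] = [set enum_val i | i in [set: 'I_#|A|]].
  apply/seteqP; split=> x /=; last by case=> i _ <-; apply: enum_valP.
  by move=> xA; exists (enum_rank_in xA x); rewrite ?enum_rankK_in.
apply: (card_eq_trans (inj_card_eq _)); last exact/card_esym/card_II.
by move=> i j _ _; exact: enum_val_inj.
Qed.

Theorem corollary21 (R : realType) (d : nat) (hd : (2 <= d)%N)
    (a b : 'I_d -> R)
    (hab : forall i, 0 < b i /\ b i <= a i)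
    (hl : exists l, b l < a l)
    (k : 'I_d) (hk : b k = a k) :
  let Kplus := dual_cone (solvency_cone (bid_ask_matrix a b)) in
  [/\ Kplus =
        cone [set y : 'cV[R]_d | exists Q : {set 'I_d},
          [/\ Q \subset [set~ k]%SET,
              forall i, i \in Q -> y i 0 = b i &
              forall j, j \notin Q -> y j 0 = a j]],
      extreme_directions Kplus #<= `I_(2 ^ (d - 1))%N &
      (forall i, i != k -> 0 < b i /\ b i < a i) ->
      extreme_directions Kplus #= `I_(2 ^ (d - 1))%N].
Proof.
rewrite (dual_bid_ask hab hk) /=.
have cardQ : avoiding k #= `I_(2 ^ (d - 1))%N.
  have := card_eq_finset (powerset [set~ k]%SET).
  rewrite card_powerset cardsC1 card_ord subn1.
  by congr (_ #= _); apply/seteqP; split=> Q; rewrite /= powersetE.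
split.
- rewrite box_coneE //; congr cone; apply/seteqP; split=> y.
    move=> [Q hQ <-]; exists Q; split=> // i; rewrite mxE; first by move->.
    by move/negbTE->.
  move=> [Q [hQ hb ha]]; exists Q => //; apply/matrixP => i j.
  by rewrite (ord1 j) mxE; case: ifPn => [/hb|/ha].
- rewrite extreme_directions_box_cone // -(card_le_eqr cardQ).
  exact: card_image_le.
- move=> hlt; rewrite extreme_directions_box_cone // -(card_eqr cardQ).
  by apply/inj_card_eq/open_ray_vertex_inj => // i /hlt[].
Qed.
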